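(* Let $(b(n))_{n\geqslant 0}$ be the sequence of real numbers determined by $b(0)=0$, $b(1)=1$ and, for all integers $n\geqslant 0$, $$b(3n)=b(n),\qquad b(3n+1)=\sqrt{2}\cdot b(n)+b(n+1),\qquad b(3n+2)=b(n)+\sqrt{2}\cdot b(n+1).$$ Then $$\limsup_{n\to\infty}\frac{2b(n)}{(2n)^{\log_3(\sqrt{2}+1)}}=1.$$
   Context: The sequence $b$ is Northshield's analogue of Stern's sequence for $\mathbb{Z}[\sqrt{2}]$. Here $\log_3 c$ denotes the base-$3$ logarithm of the real number $c>0$. *)

(* Defs.v *)
From Stdlib Require Export Reals.
From Coquelicot Require Export Coquelicot.

(* Main.v *)
Require Import Defs.
From Stdlib Require Import Reals Lra Lia Wf_nat.
From Coquelicot Require Import Coquelicot.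
Open Scope R_scope.

(** Write [lam = sqrt 2 + 1] and [alpha = log_3 lam], so that multiplying [x]
    by [3] multiplies [x ^ alpha] by [lam].

    Attach to the pair [(b n, b (n+1))] the number [2n + 1], twice the midpoint
    of its indices.  The recurrence sends this pair to three pairs, whose
    doubled midpoints are [3(2n+1) - 2], [3(2n+1)] and [3(2n+1) + 2].  The
    middle map has matrix [[sqrt 2, 1], [1, sqrt 2]]; it multiplies
    [b n + b (n+1)] by exactly [lam] and [b n - b (n+1)] by [1 / lam].  Each
    outer map gives the sum [lam (b n + b (n+1))] less [sqrt 2] times an
    entry of the pair.

    Upper bound.  By induction [b n + b (n+1) <= (2n+1) ^ alpha]
    ([adjacent_sum_le]).  The middle and right maps preserve this at once.  For
    the left map the loss is at least [sqrt 2], because [b (n+1) >= 1], whereas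
    concavity of [x ^ alpha] bounds the decrease of the right-hand side by
    [3 ^ alpha - 1 ^ alpha = sqrt 2].  A second induction, again by concavity,
    gives [2 b n <= (2n+1) ^ alpha] ([double_term_le]); since
    [((2n+1) / (2n)) ^ alpha] tends to [1], the upper limit is at most [1].

    Lower bound.  Following the middle map from the pair [(b 0, b 1)] leads to
    the indices [n] with [2n + 1 = 3 ^ k], where
    [2 b n = lam ^ k - lam ^ (-k)] ([middle_pair]).  As [(2n) ^ alpha] is at
    most [lam ^ k] there, the quotient is at least [1 - lam ^ (-2k)]. *)

(** * Concavity of real powers with exponent in (0, 1) *)

(** With [u = exp L], weight the inequalities [exp ((1-a) L) >= 1 + (1-a) L] and
    [exp (- a L) >= 1 - a L] by [a] and [1 - a]: the linear terms cancel, and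
    multiplying the sum by [exp (a L)] gives the claim. *)
Lemma Rpower_le_tangent (a u : R) :
  0 < a < 1 -> 0 < u -> Rpower u a <= 1 + a * (u - 1).
Proof.
intros Ha Hu. unfold Rpower.
set (L := ln u).
assert (Hexp : forall t, 1 + t <= exp t).
{ intros t. destruct (Req_dec t 0) as [->|Ht].
  - rewrite exp_0; lra.
  - left; now apply exp_ineq1. }
assert (Hu1 : u = exp (a * L) * exp ((1 - a) * L)).
{ rewrite <- exp_plus. replace (a * L + (1 - a) * L) with L by ring.
  unfold L; now rewrite exp_ln. }
assert (H1 : exp (a * L) * exp (- (a * L)) = 1).
{ rewrite <- exp_plus, Rplus_opp_r; apply exp_0. }
pose proof (Hexp ((1 - a) * L)) as E1.
pose proof (Hexp (- (a * L))) as E2.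
pose proof (exp_pos (a * L)) as Ep.
assert (E3 : 1 <= a * exp ((1 - a) * L) + (1 - a) * exp (- (a * L))) by nra.
apply (Rmult_le_compat_l (exp (a * L))) in E3; [|lra].
replace (exp (a * L) * (a * exp ((1 - a) * L) + (1 - a) * exp (- (a * L))))
  with (a * (exp (a * L) * exp ((1 - a) * L))
        + (1 - a) * (exp (a * L) * exp (- (a * L)))) in E3 by ring.
rewrite <- Hu1, H1 in E3. lra.
Qed.

Lemma Rpower_concave (a p q x y : R) :
  0 < a < 1 -> 0 <= p -> 0 <= q -> p + q = 1 -> 0 < x -> 0 < y ->
  p * Rpower x a + q * Rpower y a <= Rpower (p * x + q * y) a.
Proof.
intros Ha Hp Hq Hpq Hx Hy.
set (z := p * x + q * y).
assert (Hz : 0 < z) by (unfold z; destruct (Rle_lt_dec p 0); nra).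
assert (Htan : forall t, 0 < t ->
          Rpower t a <= Rpower z a * (1 + a * (t / z - 1))).
{ intros t Ht.
  replace (Rpower t a) with (Rpower z a * Rpower (t / z) a).
  - apply Rmult_le_compat_l; [left; apply exp_pos|].
    apply Rpower_le_tangent; [easy|]. now apply Rdiv_lt_0_compat.
  - rewrite Rpower_mult_distr; [|easy|now apply Rdiv_lt_0_compat].
    f_equal; field; lra. }
pose proof (Rmult_le_compat_l p _ _ Hp (Htan x Hx)) as H1.
pose proof (Rmult_le_compat_l q _ _ Hq (Htan y Hy)) as H2.
assert (Hmean : p * (x / z) + q * (y / z) = 1)
  by (replace 1 with (z / z) by (field; lra); unfold z at 3; field; lra).
replace (Rpower z a) with
  (p * (Rpower z a * (1 + a * (x / z - 1)))
   + q * (Rpower z a * (1 + a * (y / z - 1)))); [lra|].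
transitivity (Rpower z a
  * ((p + q) * (1 - a) + a * (p * (x / z) + q * (y / z)))); [ring|].
rewrite Hmean, Hpq; ring.
Qed.

(** Both inner points [x + d] and [y - d] are convex combinations of [x] and
    [y], with exchanged weights, so adding the two instances of concavity
    leaves weight [1] on each endpoint. *)
Lemma Rpower_chord (a x y d : R) :
  0 < a < 1 -> 0 < x -> x < y -> 0 <= d <= y - x ->
  Rpower x a + Rpower y a <= Rpower (x + d) a + Rpower (y - d) a.
Proof.
intros Ha Hx Hxy Hd.
set (q := d / (y - x)).
assert (Hq : q * (y - x) = d) by (unfold q; field; lra).
assert (Hq01 : 0 <= q <= 1) by (split; nra).
pose proof (Rpower_concave a (1 - q) q x y Ha ltac:(lra) ltac:(lra)
              ltac:(lra) Hx ltac:(lra)) as H1.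
pose proof (Rpower_concave a q (1 - q) x y Ha ltac:(lra) ltac:(lra)
              ltac:(lra) Hx ltac:(lra)) as H2.
replace ((1 - q) * x + q * y) with (x + d) in H1 by (rewrite <- Hq; ring).
replace (q * x + (1 - q) * y) with (y - d) in H2 by (rewrite <- Hq; ring).
lra.
Qed.

(** * The growth exponent *)

Definition lam : R := sqrt 2 + 1.
Definition alpha : R := Rlog 3 lam.

Lemma sqrt2_bounds : sqrt 2 * sqrt 2 = 2 /\ 1.4 < sqrt 2 < 1.5.
Proof.
pose proof (sqrt_sqrt 2 ltac:(lra)) as H.
pose proof (sqrt_pos 2) as H0.
split; [easy|]; split; nra.
Qed.

Lemma alpha_bounds : 0 < alpha < 1.
Proof.
pose proof sqrt2_bounds as [_ Hs].
assert (H3 : 0 < ln 3) by (rewrite <- ln_1; apply ln_increasing; lra).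
unfold alpha, Rlog. split.
- apply Rdiv_lt_0_compat; [|easy].
  rewrite <- ln_1; apply ln_increasing; unfold lam; lra.
- apply Rmult_lt_reg_r with (ln 3); [easy|].
  unfold Rdiv; rewrite Rmult_assoc, Rinv_l, Rmult_1_l, Rmult_1_r by lra.
  apply ln_increasing; unfold lam; lra.
Qed.

Lemma Rpower_3_alpha : Rpower 3 alpha = lam.
Proof.
pose proof sqrt2_bounds as [_ Hs].
apply Rpower_Rlog; unfold lam; lra.
Qed.

Lemma Rpower_1_alpha : Rpower 1 alpha = 1.
Proof. unfold Rpower; rewrite ln_1, Rmult_0_r; apply exp_0. Qed.

Lemma Rpower_triple (x : R) :
  0 < x -> Rpower (3 * x) alpha = lam * Rpower x alpha.
Proof.
intros Hx. rewrite <- Rpower_mult_distr, Rpower_3_alpha by lra. reflexivity.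
Qed.

Lemma Rpower_pow3 (k : nat) : Rpower (3 ^ k) alpha = lam ^ k.
Proof.
induction k as [|k IH]; simpl.
- apply Rpower_1_alpha.
- rewrite Rpower_triple, IH; [easy|apply pow_lt; lra].
Qed.

Lemma Rpower_alpha_le (x y : R) :
  0 < x <= y -> Rpower x alpha <= Rpower y alpha.
Proof. intros H. apply Rle_Rpower_l; [pose proof alpha_bounds; lra|easy]. Qed.

(** By concavity the increment over an interval of length [2] to the right of
    [1] is largest on the interval from [1] to [3]. *)
Lemma Rpower_drop_2 (t : R) :
  3 <= t -> Rpower t alpha - sqrt 2 <= Rpower (t - 2) alpha.
Proof.
intros Ht.
pose proof (Rpower_chord alpha 1 t 2 alpha_bounds ltac:(lra) ltac:(lra)
              ltac:(lra)) as H.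
replace (1 + 2) with 3 in H by ring.
rewrite Rpower_1_alpha, Rpower_3_alpha in H. unfold lam in H. lra.
Qed.

(** The weights [2] and [sqrt 2 - 1] add up to [lam], and the weighted mean of
    [x] and [x + 2] is [x + 2 (sqrt 2 - 1) ^ 2], which lies below [x + 2/3]. *)
Lemma Rpower_weighted_step (x : R) :
  0 < x ->
  2 * Rpower x alpha + (sqrt 2 - 1) * Rpower (x + 2) alpha
  <= Rpower (3 * x + 2) alpha.
Proof.
intros Hx. pose proof sqrt2_bounds as [Hs2 Hs].
replace (3 * x + 2) with (3 * (x + 2 / 3)) by field.
rewrite Rpower_triple by lra.
(* As [1 / lam = sqrt 2 - 1], the normalised weights are these. *)
pose proof (Rpower_concave alpha (2 * (sqrt 2 - 1))
  ((sqrt 2 - 1) * (sqrt 2 - 1)) x (x + 2) alpha_bounds ltac:(lra) ltac:(nra) ltac:(nra) Hx ltac:(lra)) as H.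
assert (Hmono : Rpower (2 * (sqrt 2 - 1) * x
                        + (sqrt 2 - 1) * (sqrt 2 - 1) * (x + 2)) alpha
                <= Rpower (x + 2 / 3) alpha)
  by (apply Rpower_alpha_le; split; nra).
pose proof (Rle_trans _ _ _ H Hmono) as H1.
apply (Rmult_le_compat_l lam) in H1; [|unfold lam; lra].
assert (Hinv : lam * (sqrt 2 - 1) = 1) by (unfold lam; nra).
replace (lam * (2 * (sqrt 2 - 1) * Rpower x alpha
                + (sqrt 2 - 1) * (sqrt 2 - 1) * Rpower (x + 2) alpha))
  with (lam * (sqrt 2 - 1) * (2 * Rpower x alpha
                + (sqrt 2 - 1) * Rpower (x + 2) alpha)) in H1 by ring.
rewrite Hinv in H1. lra.
Qed.

(** * Bounds for the sequence *)

Record northshield (b : nat -> R) : Prop := {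
  ns_0 : b 0%nat = 0;
  ns_1 : b 1%nat = 1;
  ns_3n : forall n, b (3 * n)%nat = b n;
  ns_3n1 : forall n, b (3 * n + 1)%nat = sqrt 2 * b n + b (n + 1)%nat;
  ns_3n2 : forall n, b (3 * n + 2)%nat = b n + sqrt 2 * b (n + 1)%nat }.

(** [P 1] is a separate base case because [3 n + 1 = n + 1] when [n = 0]. *)
Lemma ternary_ind (P : nat -> Prop) :
  P 0%nat -> P 1%nat ->
  (forall n, P n -> P (n + 1)%nat ->
     P (3 * n)%nat /\ P (3 * n + 1)%nat /\ P (3 * n + 2)%nat) ->
  forall n, P n.
Proof.
intros H0 H1 Hstep n. induction n as [n IH] using lt_wf_ind.
destruct (Nat.le_gt_cases n 1) as [Hn|Hn].
- destruct n as [|[|n]]; [easy|easy|lia].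
- pose proof (Nat.div_mod_eq n 3) as Hdiv.
  pose proof (Nat.mod_upper_bound n 3 ltac:(lia)) as Hmod.
  set (q := (n / 3)%nat) in *.
  destruct (Hstep q (IH q ltac:(lia)) (IH (q + 1)%nat ltac:(lia)))
    as [Ha [Hb Hc]].
  destruct (n mod 3) as [|[|[|r]]]; [| | |lia].
  + now replace n with (3 * q)%nat by lia.
  + now replace n with (3 * q + 1)%nat by lia.
  + now replace n with (3 * q + 2)%nat by lia.
Qed.

Lemma ns_nonneg_ge_1 (b : nat -> R) (Hb : northshield b) (n : nat) :
  0 <= b n /\ ((0 < n)%nat -> 1 <= b n).
Proof.
destruct Hb as [b0 b1 b3 b31 b32]. pose proof sqrt2_bounds as [_ Hs].
revert n; apply ternary_ind; [ | | intros n [Hn Hn'] [Hm Hm'] ].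
- rewrite b0; split; [lra|lia].
- rewrite b1; split; lra.
- rewrite b3, b31, b32. specialize (Hm' ltac:(lia)).
  split; [|split]; (split; [nra|]); intros Hpos; [|nra|nra].
  apply Hn'; lia.
Qed.

Lemma ns_succ_ge_1 (b : nat -> R) (Hb : northshield b) (n : nat) :
  1 <= b (n + 1)%nat.
Proof. apply ns_nonneg_ge_1; [easy|lia]. Qed.

(** The bound is an equality whenever [2 n + 1] is a power of [3].  Already
    the left image of the pair at [n = 0] is that pair again, so there the loss
    [sqrt 2 * b 1] and the drop [3 ^ alpha - 1 ^ alpha] must agree exactly. *)
Lemma adjacent_sum_le (b : nat -> R) (Hb : northshield b) (n : nat) :
  b n + b (n + 1)%nat <= Rpower (2 * INR n + 1) alpha.
Proof.
pose proof sqrt2_bounds as [Hs2 Hs].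
revert n; apply ternary_ind; [ | | intros n IH _ ].
- simpl. rewrite (ns_0 b Hb), (ns_1 b Hb).
  replace (2 * 0 + 1) with 1 by ring. rewrite Rpower_1_alpha; lra.
- pose proof (ns_3n2 b Hb 0) as H2. simpl in H2 |- *.
  rewrite H2, (ns_0 b Hb), (ns_1 b Hb).
  replace (2 * 1 + 1) with 3 by ring. rewrite Rpower_3_alpha; unfold lam; lra.
- pose proof (pos_INR n) as Hn.
  pose proof (proj1 (ns_nonneg_ge_1 b Hb n)) as Hbn.
  pose proof (ns_succ_ge_1 b Hb n) as Hbm.
  set (m := 2 * INR n + 1) in *.
  assert (Hlam : lam * (b n + b (n + 1)%nat) <= Rpower (3 * m) alpha).
  { rewrite Rpower_triple by (unfold m; lra).
    apply Rmult_le_compat_l; [unfold lam; lra|easy]. }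
  unfold lam in Hlam.
  assert (H3n : INR (3 * n) = 3 * INR n)
    by (rewrite mult_INR; simpl; ring).
  split; [|split].
  + rewrite (ns_3n1 b Hb), (ns_3n b Hb), H3n.
    replace (2 * (3 * INR n) + 1) with (3 * m - 2) by (unfold m; ring).
    pose proof (Rpower_drop_2 (3 * m) ltac:(unfold m; lra)). nra.
  + replace (3 * n + 1 + 1)%nat with (3 * n + 2)%nat by lia.
    rewrite (ns_3n1 b Hb), (ns_3n2 b Hb), plus_INR, H3n.
    replace (2 * (3 * INR n + INR 1) + 1) with (3 * m)
      by (unfold m; simpl; ring).
    lra.
  + replace (3 * n + 2 + 1)%nat with (3 * (n + 1))%nat by lia.
    rewrite (ns_3n2 b Hb), (ns_3n b Hb), plus_INR, H3n.
    replace (2 * (3 * INR n + INR 2) + 1) with (3 * m + 2)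
      by (unfold m; simpl; ring).
    pose proof (Rpower_alpha_le (3 * m) (3 * m + 2) ltac:(unfold m; lra)).
    nra.
Qed.

(** A single term is dominated through the identities
    [2 b (3n+1) = 2 (b n + b (n+1)) + (sqrt 2 - 1) (2 b n)] and
    [2 b (3n+2) = 2 (b n + b (n+1)) + (sqrt 2 - 1) (2 b (n+1))], whose weights
    [2] and [sqrt 2 - 1] add up to [lam]. *)
Lemma double_term_le (b : nat -> R) (Hb : northshield b) (n : nat) :
  2 * b n <= Rpower (2 * INR n + 1) alpha.
Proof.
pose proof sqrt2_bounds as [Hs2 Hs].
revert n; apply ternary_ind; [ | | intros n IHn IHm ].
- rewrite (ns_0 b Hb). simpl.
  replace (2 * 0 + 1) with 1 by ring. rewrite Rpower_1_alpha; lra.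
- rewrite (ns_1 b Hb). simpl.
  replace (2 * 1 + 1) with 3 by ring. rewrite Rpower_3_alpha; unfold lam; lra.
- pose proof (pos_INR n) as Hn.
  pose proof (adjacent_sum_le b Hb n) as Hsum.
  assert (H3n : INR (3 * n) = 3 * INR n)
    by (rewrite mult_INR; simpl; ring).
  rewrite (ns_3n b Hb), (ns_3n1 b Hb), (ns_3n2 b Hb), !plus_INR, H3n.
  rewrite plus_INR in IHm.
  replace (2 * (INR n + INR 1) + 1) with (2 * INR n + 1 + 2) in IHm
    by (simpl; ring).
  replace (2 * (3 * INR n + INR 1) + 1) with (3 * (2 * INR n + 1))
    by (simpl; ring).
  replace (2 * (3 * INR n + INR 2) + 1) with (3 * (2 * INR n + 1) + 2)
    by (simpl; ring).
  split; [|split].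
  + pose proof (Rpower_alpha_le (2 * INR n + 1) (2 * (3 * INR n) + 1)
                  ltac:(lra)). lra.
  + rewrite Rpower_triple by lra. unfold lam. nra.
  + pose proof (Rpower_weighted_step (2 * INR n + 1) ltac:(lra)). nra.
Qed.

(** The middle map has eigenvectors [(1, 1)] and [(1, -1)] with eigenvalues
    [lam] and [sqrt 2 - 1 = 1 / lam]; the start [(b 0, b 1) = (0, 1)] has
    coordinate sum [1] and difference [1]. *)
Lemma middle_pair (b : nat -> R) (Hb : northshield b) (k : nat) :
  exists n : nat, (k <= n)%nat /\ 2 * INR n + 1 = 3 ^ k /\
    b n + b (n + 1)%nat = lam ^ k /\ b (n + 1)%nat - b n = (sqrt 2 - 1) ^ k.
Proof.
pose proof sqrt2_bounds as [Hs2 Hs].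
induction k as [|k [n [Hkn [Hn [Hsum Hdiff]]]]].
- exists 0%nat. simpl. rewrite (ns_0 b Hb), (ns_1 b Hb).
  repeat split; [lia|ring|ring|ring].
- exists (3 * n + 1)%nat.
  replace (3 * n + 1 + 1)%nat with (3 * n + 2)%nat by lia.
  rewrite (ns_3n1 b Hb), (ns_3n2 b Hb), plus_INR, mult_INR.
  split; [lia|]. simpl pow. rewrite <- Hn, <- Hsum, <- Hdiff.
  unfold lam; simpl; repeat split; ring.
Qed.

(** * The upper limit *)

Lemma ratio_le (b : nat -> R) (Hb : northshield b) (n : nat) :
  (0 < n)%nat -> 2 * b n / Rpower (2 * INR n) alpha <= 1 + / INR n.
Proof.
intros Hpos. apply lt_0_INR in Hpos.
pose proof alpha_bounds as Ha.
assert (Hp : 0 < Rpower (2 * INR n) alpha) by apply exp_pos.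
assert (Hi : 0 < / INR n) by now apply Rinv_0_lt_compat.
apply Rle_div_l; [easy|].
apply Rle_trans with (1 := double_term_le b Hb n).
replace (2 * INR n + 1) with ((1 + / INR n / 2) * (2 * INR n)) by (field; lra).
rewrite <- Rpower_mult_distr by lra.
apply Rmult_le_compat_r; [lra|].
pose proof (Rpower_le_tangent alpha (1 + / INR n / 2) Ha ltac:(lra)). nra.
Qed.

Lemma ratio_ge_middle (b : nat -> R) (Hb : northshield b) (k : nat) :
  (0 < k)%nat -> exists n : nat, (k <= n)%nat /\
    1 - (sqrt 2 - 1) ^ k <= 2 * b n / Rpower (2 * INR n) alpha.
Proof.
intros Hk. pose proof sqrt2_bounds as [Hs2 Hs].
destruct (middle_pair b Hb k) as [n [Hkn [Hn [Hsum Hdiff]]]].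
exists n; split; [easy|].
assert (Hpos : 0 < INR n) by (apply lt_0_INR; lia).
assert (Hp : 0 < Rpower (2 * INR n) alpha) by apply exp_pos.
assert (Hle : Rpower (2 * INR n) alpha <= lam ^ k).
{ rewrite <- Rpower_pow3. apply Rpower_alpha_le; lra. }
assert (Hl : 1 <= lam ^ k) by (apply pow_R1_Rle; unfold lam; lra).
set (e := (sqrt 2 - 1) ^ k) in *.
assert (He : 0 < e) by (apply pow_lt; lra).
assert (He1 : e <= 1)
  by (replace 1 with (1 ^ k) by apply pow1; apply pow_incr; lra).
apply Rle_div_r; [easy|].
(* Here [2 b n = lam ^ k - e], and [e <= e * lam ^ k]. *)
nra.
Qed.

Theorem theorem1 (b : nat -> R)
  (b0 : b 0%nat = 0)
  (b1 : b 1%nat = 1)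
  (b3n : forall n : nat, b (3 * n)%nat = b n)
  (b3n1 : forall n : nat, b (3 * n + 1)%nat = sqrt 2 * b n + b (n + 1)%nat)
  (b3n2 : forall n : nat, b (3 * n + 2)%nat = b n + sqrt 2 * b (n + 1)%nat) :
  LimSup_seq (fun n : nat => 2 * b n / Rpower (2 * INR n) (Rlog 3 (sqrt 2 + 1)))
  = Finite 1.
Proof.
assert (Hb : northshield b) by now split.
pose proof sqrt2_bounds as [Hs2 Hs].
apply is_LimSup_seq_unique. intros [eps Heps]; simpl.
change (Rlog 3 (sqrt 2 + 1)) with alpha.
split.
- intros N.
  destruct (pow_lt_1_zero (sqrt 2 - 1) ltac:(apply Rabs_def1; lra) eps Heps)
    as [K HK].
  set (k := (S (N + K))%nat).
  destruct (ratio_ge_middle b Hb k ltac:(unfold k; lia)) as [n [Hkn Hn]].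
  exists n. split; [unfold k in Hkn; lia|].
  pose proof (Rabs_def2 _ _ (HK k ltac:(unfold k; lia))). lra.
- destruct (archimed_cor1 eps Heps) as [N [HN HN0]].
  exists N. intros n Hn.
  pose proof (ratio_le b Hb n ltac:(lia)) as Hr.
  assert (Hinv : / INR n <= / INR N).
  { apply Rinv_le_contravar; [now apply lt_0_INR|now apply le_INR]. }
  lra.
Qed.
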